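(* Let $y\in\mathbb{R}^n$ and let $(\hat u^{(k)})_{k\ge1}$, $(\hat b^{(k)})_{k\ge0}$ be the sequences produced by the Iterative Isotonic Regression algorithm applied to $y$. Then these sequences converge, with $$\lim_{k\to\infty}\hat u^{(k)}=u_y^\star\qquad\text{and}\qquad\lim_{k\to\infty}\hat b^{(k)}=b_y^\star,$$ where $u_y^\star\in\mathcal{C}^+$ and $b_y^\star\in\mathcal{C}^-$ are the vectors such that $y=u_y^\star+b_y^\star$, $\overline{u_y^\star}=\bar y$, $\overline{b_y^\star}=0$ and $\Delta(u_y^\star)\circ\Delta(b_y^\star)=0$.
   Context: Let $\mathcal{C}^+=\{u\in\mathbb{R}^n: u_1\le\dots\le u_n\}$ and $\mathcal{C}^-=-\mathcal{C}^+=\{b\in\mathbb{R}^n: b_1\ge\dots\ge b_n\}$. For $z\in\mathbb{R}^n$, $\mathrm{iso}(z)=\arg\min_{u\in\mathcal{C}^+}\|z-u\|^2$ and $\mathrm{anti}(z)=\arg\min_{b\in\mathcal{C}^-}\|z-b\|^2$ are the Euclidean metric projections of $z$ onto $\mathcal{C}^+$ and $\mathcal{C}^-$. Iterative Isotonic Regression applied to $y$: $\hat b^{(0)}=0$ and, for $k\ge1$, $\hat u^{(k)}=\mathrm{iso}(y-\hat b^{(k-1)})$, $\hat b^{(k)}=\mathrm{anti}(y-\hat u^{(k)})$. For $z\in\mathbb{R}^n$, $\bar z=\frac1n\sum_{i=1}^n z_i$ and $\Delta(z)=(z_2-z_1,\dots,z_n-z_{n-1})\in\mathbb{R}^{n-1}$;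 $\circ$ denotes the term-by-term (Hadamard) product. The pair $(u_y^\star,b_y^\star)$ is the discrete analogue of the Jordan minimum variation decomposition of $y$ into a non-decreasing and a non-increasing part; it is uniquely determined by the listed conditions. *)

(* Defs.v *)
From mathcomp Require Import all_boot all_order all_algebra.
From mathcomp Require Import all_classical all_reals all_analysis.

Set Implicit Arguments.
Unset Strict Implicit.
Unset Printing Implicit Defensive.

Import Order.TTheory GRing.Theory Num.Theory.
Import numFieldNormedType.Exports.

Local Open Scope classical_set_scope.
Local Open Scope ring_scope.

Definition isotone (R : realType) (n : nat) : set 'rV[R]_n :=
  [set u | forall i j : 'I_n, (i <= j)%N -> u 0 i <= u 0 j].

Definition antitone (R : realType) (n : nat) : set 'rV[R]_n :=
  [set b | forall i j : 'I_n, (i <= j)%N -> b 0 j <= b 0 i].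

(* The library norm on matrices is the sup norm, hence this explicit squared
   Euclidean norm. *)
Definition sqnorm2 (R : realType) (n : nat) (z : 'rV[R]_n) : R :=
  \sum_i z 0 i ^+ 2.

(* [get] returns an arbitrary default vector when [A] has no point nearest to
   [z]; this does not happen for the closed convex cones [isotone] and
   [antitone], where moreover the minimizer is unique. *)
Definition metric_proj (R : realType) (n : nat) (A : set 'rV[R]_n)
    (z : 'rV[R]_n) : 'rV[R]_n :=
  get [set u | A u /\ forall v, A v -> sqnorm2 (z - u) <= sqnorm2 (z - v)].

Definition iso (R : realType) (n : nat) (z : 'rV[R]_n) : 'rV[R]_n :=
  metric_proj (@isotone R n) z.

Definition anti (R : realType) (n : nat) (z : 'rV[R]_n) : 'rV[R]_n :=
  metric_proj (@antitone R n) z.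

Fixpoint iir_b (R : realType) (n : nat) (y : 'rV[R]_n) (k : nat) : 'rV[R]_n :=
  if k is k'.+1 then anti (y - iso (y - iir_b y k')) else 0.

(* Meaningful for [k >= 1] only: [iir_u y 0] is a dummy value, and
   [iir_b y k.+1] is convertible to [anti (y - iir_u y k.+1)]. *)
Definition iir_u (R : realType) (n : nat) (y : 'rV[R]_n) (k : nat) : 'rV[R]_n :=
  iso (y - iir_b y k.-1).

Definition mean (R : realType) (n : nat) (z : 'rV[R]_n) : R :=
  (\sum_i z 0 i) / n%:R.

Definition Delta (R : realType) (n : nat) (z : 'rV[R]_n.+1) : 'rV[R]_n :=
  \row_(i < n) (z 0 (lift ord0 i) - z 0 (widen_ord (leqnSn n) i)).

Definition jordan_decomposition (R : realType) (n : nat)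
    (y u b : 'rV[R]_n.+1) : Prop :=
  [/\ isotone u /\ antitone b,
      y = u + b,
      mean u = mean y,
      mean b = 0 &
      map2_mx *%R (Delta u) (Delta b) = 0].

(* Main.v *)
Require Import Defs.
From mathcomp Require Import all_boot all_order all_algebra.
From mathcomp Require Import all_classical all_reals all_analysis.
From mathcomp Require Import ring lra.

(** The algorithm alternates projections, so for a Jordan decomposition
    [y = u + b] the squared distances to [u] and [b] decrease: each half-step
    loses at least the squared norm of the current residual
    ([obtuse_pythagoras]), and the residual tends to 0. This alone would only
    give convergence to some decomposition of [y] into an isotone and an
    antitone part. What selects the Jordan decomposition is that isotonic
    regression never creates or enlarges an increase of its datum
    ([nearest_isotone_Delta]). Starting from [b_0 = 0], induction then shows
    that the iterates [u_k], [b_k] vary no more than [u], [b] do: [u - u_k] is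
    isotone and [b - b_k] antitone ([isotone_step], [antitone_step]).

    Since [u] and [b] never vary at the same place, neither do these two
    deficits, and each increment of their sum, the residual
    [y - u_k - b_k], is an increment of one of them alone. As the projections
    also fix the means, a centred deficit is controlled by its increments and
    therefore by the residual ([norm_deficit_le_residual]): both deficits tend
    to 0, with no need to extract convergent subsequences. Existence and
    uniqueness of the decomposition come from the increments of [u] being the
    positive parts of those of [y]. *)

Set Implicit Arguments.
Unset Strict Implicit.
Unset Printing Implicit Defensive.

Import Order.TTheory GRing.Theory Num.Theory.
Import numFieldNormedType.Exports.

Local Open Scope classical_set_scope.
Local Open Scope ring_scope.

(** * Inner product and nearest points *)

Definition dot (R : realType) (n : nat) (x z : 'rV[R]_n) : R :=
  \sum_i x 0 i * z 0 i.

Definition nearest (R : realType) (n : nat) (A : set 'rV[R]_n)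
    (z v : 'rV[R]_n) : Prop :=
  A v /\ forall p, A p -> sqnorm2 (z - v) <= sqnorm2 (z - p).

Lemma sqnorm2_ge0 (R : realType) n (z : 'rV[R]_n) : 0 <= sqnorm2 z.
Proof. by apply: sumr_ge0 => i _; apply: sqr_ge0. Qed.

Lemma sqnorm2N (R : realType) n (z : 'rV[R]_n) : sqnorm2 (- z) = sqnorm2 z.
Proof. by apply: eq_bigr => i _; rewrite mxE sqrrN. Qed.

Lemma sqnorm2_lincomb (R : realType) n (x z : 'rV[R]_n) (t : R) :
  sqnorm2 (x + t *: z) = sqnorm2 x + 2 * t * dot x z + t ^+ 2 * sqnorm2 z.
Proof.
rewrite /sqnorm2 /dot !mulr_sumr -!big_split /=.
by apply: eq_bigr => i _; rewrite !mxE; ring.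
Qed.

Lemma norm_eq_entry (R : realType) n (z : 'rV[R]_n.+1) :
  exists i, `|z| = `|z 0 i|.
Proof.
have [->|z0] := eqVneq z 0; first by exists 0; rewrite mxE !normr0.
have [[i j] /= ->] : exists ij, `|z| = `|z ij.1 ij.2|.
  by apply: mx_norm_neq0; rewrite -[mx_norm z]/(`|z|) normr_eq0.
by exists j; rewrite ord1.
Qed.

Lemma norm_entry_le (R : realType) n (z : 'rV[R]_n.+1) i : `|z 0 i| <= `|z|.
Proof.
rewrite -[`|z|]/(mx_norm z) mx_normrE.
exact: (le_bigmax _ (fun ij => `|z ij.1 ij.2|) (0, i)).
Qed.

Lemma sqr_norm_le_sqnorm2 (R : realType) n (z : 'rV[R]_n.+1) :
  `|z| ^+ 2 <= sqnorm2 z.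
Proof.
have [j zj] := norm_eq_entry z.
rewrite zj real_normK ?num_real// /sqnorm2 (bigD1 j)//= lerDl.
by apply: sumr_ge0 => k _; apply: sqr_ge0.
Qed.

Lemma continuous_sqnorm2B (R : realType) n (z : 'rV[R]_n.+1) :
  continuous (fun v : 'rV[R]_n.+1 => sqnorm2 (z - v)).
Proof.
apply: (@continuous_big _ _ +%R 0 xpredT (@add_continuous R^o)) => i _ v.
have -> : (fun v : 'rV[R]_n.+1 => (z - v) 0 i ^+ 2) =
    (fun v => (z 0 i - v 0 i) ^+ 2).
  by apply/funext => w; rewrite !mxE.
apply: (@continuous_comp _ _ _ (fun v : 'rV[R]_n.+1 => z 0 i - v 0 i)
    (fun x : R => x ^+ 2)).
  by apply: continuousB; [exact: cst_continuous | exact: coord_continuous].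
exact: exprn_continuous.
Qed.

(** A point of [A] at least as close to [z] as a fixed [a] lies in a bounded
    set, so the distance to [z] attains its minimum on [A] by compactness. *)
Lemma metric_projP (R : realType) n (A : set 'rV[R]_n.+1) (z : 'rV[R]_n.+1) :
  closed A -> A !=set0 -> nearest A z (metric_proj A z).
Proof.
move=> clA [a Aa]; apply: (@getPex _ (nearest A z)).
pose B := A `&` [set v | sqnorm2 (z - v) <= sqnorm2 (z - a)].
have clB : closed B.
  apply: closedI => //.
  rewrite -[X in closed X]/((fun v : 'rV[R]_n.+1 => sqnorm2 (z - v)) @^-1`
    [set x | x <= sqnorm2 (z - a)]).
  apply: preimage_closed; last exact: closed_le.
  by move=> v _; exact: continuous_sqnorm2B.
have bdB : bounded_set B.
  (* The added 1 turns a bound on a square into one on its root. *)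
  exists (`|z| + (sqnorm2 (z - a) + 1)); split; first exact: num_real.
  move=> M ltM v [_ /= vle]; apply: le_trans (ltW ltM).
  have -> : v = z - (z - v) by rewrite subKr.
  apply: le_trans (ler_normB _ _) _; rewrite lerD2l.
  have := sqr_norm_le_sqnorm2 (z - v).
  have := normr_ge0 (z - v); nra.
have cB := bounded_closed_compact bdB clB.
have B0 : B !=set0 by exists a; split => /=.
have [v /set_mem[Av va] vmin] := EVT_min_rV B0 cB
  (continuous_subspaceT (@continuous_sqnorm2B _ _ z)).
exists v; split=> // p Ap.
have [pa|pa] := leP (sqnorm2 (z - p)) (sqnorm2 (z - a)).
  by apply: vmin; apply/mem_set.
exact: le_trans va (ltW pa).
Qed.

(** If the angle at [v] between [z] and a point [p] of [A] were acute, moving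
    from [v] a little towards [p] would get closer to [z]. *)
Lemma nearest_obtuse (R : realType) n (A : set 'rV[R]_n) (z v p : 'rV[R]_n) :
  (forall t, 0 <= t -> t <= 1 -> A (v + t *: (p - v))) ->
  nearest A z v -> dot (z - v) (p - v) <= 0.
Proof.
move=> Aseg [_ vmin]; set a := dot _ _; pose q := sqnorm2 (p - v).
have q0 : 0 <= q by exact: sqnorm2_ge0.
rewrite leNgt; apply/negP => a0.
(* The distance along the segment decreases up to the step [a / q]; this smaller
   step is moreover at most 1, and defined when [q] vanishes. *)
pose t := a / (a + q); have aq0 : 0 < a + q by rewrite ltr_pwDl.
have t0 : 0 < t by rewrite divr_gt0.
have t1 : t <= 1 by rewrite ler_pdivrMr// mul1r lerDl.
have := vmin _ (Aseg t (ltW t0) t1).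
rewrite opprD addrA -scaleNr sqnorm2_lincomb -/a -/q.
have : t * (a + q) = a by rewrite divfK// gt_eqF.
nra.
Qed.

Lemma obtuse_pythagoras (R : realType) n (z v p : 'rV[R]_n) :
  dot (z - v) (p - v) <= 0 ->
  sqnorm2 (p - v) + sqnorm2 (z - v) <= sqnorm2 (p - z).
Proof.
have -> : p - z = - ((z - v) + (-1) *: (p - v)).
  by rewrite scaleN1r !opprB addrA subrK.
by rewrite sqnorm2N sqnorm2_lincomb; lra.
Qed.

(** * Increments *)

Lemma DeltaE (R : realType) n (z : 'rV[R]_n.+1) (k : 'I_n) :
  Delta z 0 k = z 0 (lift ord0 k) - z 0 (widen_ord (leqnSn n) k).
Proof. by rewrite mxE. Qed.

Lemma DeltaD (R : realType) n (x z : 'rV[R]_n.+1) k :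
  Delta (x + z) 0 k = Delta x 0 k + Delta z 0 k.
Proof. by rewrite !mxE; ring. Qed.

Lemma DeltaB (R : realType) n (x z : 'rV[R]_n.+1) k :
  Delta (x - z) 0 k = Delta x 0 k - Delta z 0 k.
Proof. by rewrite !mxE; ring. Qed.

Lemma sum_Delta (R : realType) n (z : 'rV[R]_n.+1) (i j : 'I_n.+1) :
  (i <= j)%N ->
  z 0 j - z 0 i = \sum_(k < n | (i <= k < j)%N) Delta z 0 k.
Proof.
move=> ij; pose f k := z 0 (inord k).
have jn : (j <= n)%N by rewrite -ltnS.
transitivity (f j - f i); first by rewrite /f !inord_val.
rewrite -telescope_sumr// (big_nat_widen _ _ _ _ _ jn) big_geq_mkord.
apply: eq_big => [k|k _]; first by rewrite andbC.
by rewrite DeltaE /f; congr (z 0 _ - z 0 _); apply: val_inj;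
  rewrite /= inordK ?/bump//= ltnS// ltnW.
Qed.

Lemma isotoneP (R : realType) n (u : 'rV[R]_n.+1) :
  isotone u <-> forall k, 0 <= Delta u 0 k.
Proof.
split=> [iu k|du i j ij].
  by rewrite DeltaE subr_ge0; apply: iu; rewrite /= /bump leqnSn.
by rewrite -subr_ge0 sum_Delta//; apply: sumr_ge0.
Qed.

Lemma antitone_oppP (R : realType) n (b : 'rV[R]_n) :
  antitone b <-> isotone (- b).
Proof.
by split=> ab i j ij; have := ab _ _ ij; rewrite !mxE lerN2.
Qed.

Lemma antitoneP (R : realType) n (b : 'rV[R]_n.+1) :
  antitone b <-> forall k, Delta b 0 k <= 0.
Proof.
rewrite antitone_oppP isotoneP.
have E k : (0 <= Delta (- b) 0 k) = (Delta b 0 k <= 0).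
  by rewrite !mxE -opprD oppr_ge0.
by split=> db k; move: (db k); rewrite E.
Qed.

Lemma meanD (R : realType) n (x z : 'rV[R]_n) : mean (x + z) = mean x + mean z.
Proof.
rewrite /mean -mulrDl -big_split; congr (_ / _).
by apply: eq_bigr => i _; rewrite mxE.
Qed.

Lemma meanN (R : realType) n (z : 'rV[R]_n) : mean (- z) = - mean z.
Proof.
rewrite /mean -mulNr -sumrN; congr (_ / _).
by apply: eq_bigr => i _; rewrite mxE.
Qed.

Lemma mean_const (R : realType) n (c : R) : mean (const_mx c : 'rV[R]_n.+1) = c.
Proof.
rewrite /mean (eq_bigr (fun=> c)) => [|i _]; last by rewrite mxE.
by rewrite sumr_const card_ord -[c *+ _]mulr_natr mulfK ?pnatr_eq0.
Qed.

(** Each entry of a centred vector is the average of its differences with the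
    other entries, and every such difference is a sum of increments. *)
Lemma norm_le_sum_Delta (R : realType) n (z : 'rV[R]_n.+1) :
  mean z = 0 -> `|z| <= \sum_k `|Delta z 0 k|.
Proof.
move=> z0; set s := \sum_k _.
have s0 : 0 <= s by apply: sumr_ge0.
have leij (i j : 'I_n.+1) : (i <= j)%N -> `|z 0 j - z 0 i| <= s.
  move=> ij; rewrite sum_Delta//; apply: le_trans (ler_norm_sum _ _ _) _.
  by rewrite /s big_mkcond; apply: ler_sum => k _; case: ifP.
have dist (i j : 'I_n.+1) : `|z 0 j - z 0 i| <= s.
  by case/orP: (leq_total i j) => /leij//; rewrite distrC.
have [j ->] := norm_eq_entry z.
rewrite -[z 0 j]subr0 -z0 -[z 0 j](mean_const n) -meanN -meanD /mean.
rewrite normrM normfV normr_nat ler_pdivrMr ?ltr0n//.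
apply: le_trans (ler_norm_sum _ _ _) _.
apply: (@le_trans _ _ (\sum_(i < n.+1) s)).
  by apply: ler_sum => k _; rewrite !mxE.
by rewrite sumr_const card_ord mulr_natr.
Qed.

Lemma Delta_mean_inj (R : realType) n (x z : 'rV[R]_n.+1) :
  Delta x = Delta z -> mean x = mean z -> x = z.
Proof.
move=> dxz mxz; apply/eqP; rewrite -subr_eq0 -normr_le0.
have m0 : mean (x - z) = 0 by rewrite meanD meanN mxz subrr.
apply: le_trans (norm_le_sum_Delta m0) _.
by rewrite big1// => k _; rewrite DeltaB dxz subrr normr0.
Qed.

(** The partial sums of [d], shifted by a constant to adjust the mean. *)
Lemma exists_Delta_mean (R : realType) n (d : 'rV[R]_n) (m : R) :
  exists u : 'rV[R]_n.+1, Delta u = d /\ mean u = m.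
Proof.
pose w : 'rV[R]_n.+1 := \row_i \sum_(k < n | (k < i)%N) d 0 k.
exists (w + const_mx (m - mean w)); split; last first.
  by rewrite meanD mean_const addrC subrK.
apply/rowP => j; rewrite DeltaE !mxE /= /bump leq0n add1n.
rewrite (bigD1 j)//= opprD addrACA subrr addr0.
rewrite (eq_bigl (fun k : 'I_n => (k < j)%N)) ?addrK// => k.
by rewrite ltnS ltn_neqAle andbC.
Qed.

(** * Projection onto the isotone and antitone cones *)

Lemma closed_isotone (R : realType) n : closed (@isotone R n.+1).
Proof.
have -> : @isotone R n.+1 =
    \bigcap_(ij in [set ij : 'I_n.+1 * 'I_n.+1 | (ij.1 <= ij.2)%N])
      ((fun u : 'rV[R]_n.+1 => u 0 ij.1 - u 0 ij.2) @^-1` [set x | x <= 0]).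
  apply/seteqP; split=> u iu.
    by move=> [i j] /= /iu; rewrite subr_le0.
  by move=> i j ij; rewrite -subr_le0; apply: (iu (i, j)).
apply: closed_bigI => -[i j] _; apply: preimage_closed; last exact: closed_le.
by move=> u _; apply: continuousB; exact: coord_continuous.
Qed.

Lemma closed_antitone (R : realType) n : closed (@antitone R n.+1).
Proof.
have -> : @antitone R n.+1 = -%R @^-1` (@isotone R n.+1).
  by apply/seteqP; split=> b /antitone_oppP.
apply: preimage_closed; last exact: closed_isotone.
by move=> b _; exact: opp_continuous.
Qed.

Lemma nearest_iso (R : realType) n (z : 'rV[R]_n.+1) :
  nearest (@isotone R n.+1) z (iso z).
Proof.
apply: metric_projP; first exact: closed_isotone.
by exists 0 => i j _; rewrite !mxE.
Qed.

Lemma nearest_anti (R : realType) n (z : 'rV[R]_n.+1) :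
  nearest (@antitone R n.+1) z (anti z).
Proof.
apply: metric_projP; first exact: closed_antitone.
by exists 0 => i j _; rewrite !mxE.
Qed.

(** Negation exchanges the two cones. Stating this for nearest points rather
    than for the projection operators dispenses with their uniqueness. *)
Lemma nearest_antitoneN (R : realType) n (z v : 'rV[R]_n) :
  nearest (@antitone R n) z v -> nearest (@isotone R n) (- z) (- v).
Proof.
move=> [av vmin]; split=> [|p ip]; first exact/antitone_oppP.
rewrite -opprD sqnorm2N -[p]opprK -opprD sqnorm2N; apply: vmin.
by apply/antitone_oppP; rewrite opprK.
Qed.

Lemma nearest_isotone_obtuse (R : realType) n (z v p : 'rV[R]_n) :
  nearest (@isotone R n) z v -> isotone p -> dot (z - v) (p - v) <= 0.
Proof.
move=> nv ip; apply: nearest_obtuse (nv) => t t0 t1 i j ij; rewrite !mxE.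
have := nv.1 _ _ ij; have := ip _ _ ij; nra.
Qed.

(** Isotonic regression never creates or enlarges an increase. Where the
    projection [v] jumps, its left value can be raised and its right value
    lowered without leaving the cone; since neither move gets closer to [z],
    the datum [z] lies below [v] on the left and above [v] on the right. *)
Lemma nearest_isotone_Delta (R : realType) n (z v : 'rV[R]_n.+1) (k : 'I_n) :
  nearest (@isotone R n.+1) z v -> Delta v 0 k <= Num.max 0 (Delta z 0 k).
Proof.
move=> nv; rewrite le_max; have [//|gap /=] := leP (Delta v 0 k) 0.
have perturb i t : isotone (v + t *: delta_mx 0 i) -> t * (z 0 i - v 0 i) <= 0.
  move=> /(nearest_isotone_obtuse nv); rewrite [v + _]addrC addrK /dot.
  rewrite (bigD1 i)//= big1 => [|j ji]; last by rewrite !mxE (negbTE ji) andbF !mulr0.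
  by rewrite !mxE !eqxx mulr1 addr0 mulrC.
have iv := nv.1; move: gap; rewrite !DeltaE.
set r := lift ord0 k; set l := widen_ord _ k => gap.
have rl : r = l.+1 :> nat by [].
set g := v 0 r - v 0 l in gap *.
have left_le : z 0 l <= v 0 l.
  suff : g * (z 0 l - v 0 l) <= 0 by rewrite pmulr_rle0// subr_le0.
  apply: perturb => i j ij; rewrite !mxE /=.
  have := iv _ _ ij; have [il|_] := eqVneq i l; have [jl|jl] := eqVneq j l;
    rewrite ?mulr1 ?mulr0; try lra.
  have rj : (r <= j)%N by rewrite rl -il ltn_neqAle ij andbT il eq_sym.
  by have := iv _ _ rj; rewrite il /g; lra.
have right_ge : v 0 r <= z 0 r.
  suff : - g * (z 0 r - v 0 r) <= 0.
    by rewrite mulNr oppr_le0 pmulr_rge0// subr_ge0.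
  apply: perturb => i j ij; rewrite !mxE /=.
  have := iv _ _ ij; have [ir|ir] := eqVneq i r; have [jr|_] := eqVneq j r;
    rewrite ?mulr1 ?mulr0; try lra.
  have il : (i <= l)%N by rewrite -ltnS -rl -jr ltn_neqAle ij andbT jr.
  by have := iv _ _ il; rewrite jr /g; lra.
by rewrite lerB.
Qed.

(** The cone contains the whole line of constant vectors, so the residual is
    orthogonal to it. *)
Lemma nearest_isotone_mean (R : realType) n (z v : 'rV[R]_n.+1) :
  nearest (@isotone R n.+1) z v -> mean v = mean z.
Proof.
move=> nv; pose s := \sum_i (z - v) 0 i.
have : isotone (v + const_mx s).
  by move=> i j ij; rewrite !mxE lerD2r; apply: nv.1.
move=> /(nearest_isotone_obtuse nv); rewrite [v + _]addrC addrK.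
have -> : dot (z - v) (const_mx s) = s ^+ 2.
  by rewrite expr2 {2}/s mulr_suml; apply: eq_bigr => i _;
    rewrite [const_mx _ _ _]mxE.
rewrite le_eqVlt ltNge sqr_ge0 orbF sqrf_eq0 => /eqP s0.
by apply/eqP; rewrite eq_sym -subr_eq0 -meanN -meanD /mean -/s s0 mul0r.
Qed.

(** Subtracting an antitone perturbation lowers the increments of the datum,
    and the projection cannot enlarge them; hence [v] increases no more than
    [u] does. *)
Lemma isotone_step (R : realType) n (u c v : 'rV[R]_n.+1) :
  isotone u -> antitone c -> nearest (@isotone R n.+1) (u + c) v ->
  [/\ isotone (u - v), mean v = mean (u + c) &
      sqnorm2 (u - v) + sqnorm2 (u + c - v) <= sqnorm2 c].
Proof.
move=> iu ac nv; split.
- apply/isotoneP => k; have := nearest_isotone_Delta k nv.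
  move: (iu) (ac) => /isotoneP/(_ k) + /antitoneP/(_ k).
  by rewrite DeltaD DeltaB le_max => ? ? /orP[] ?; lra.
- exact: nearest_isotone_mean.
have := obtuse_pythagoras (nearest_isotone_obtuse nv iu).
by rewrite opprD addrA subrr add0r sqnorm2N.
Qed.

Lemma antitone_step (R : realType) n (b c v : 'rV[R]_n.+1) :
  antitone b -> isotone c -> nearest (@antitone R n.+1) (b + c) v ->
  [/\ antitone (b - v), mean v = mean (b + c) &
      sqnorm2 (b - v) + sqnorm2 (b + c - v) <= sqnorm2 c].
Proof.
move=> /antitone_oppP ab ic /nearest_antitoneN; rewrite opprD => nv.
have ac : antitone (- c) by apply/antitone_oppP; rewrite opprK.
have [iv mv sv] := isotone_step ab ac nv; split.
- by apply/antitone_oppP; rewrite opprD.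
- by apply: oppr_inj; rewrite -!meanN opprD.
by move: sv; rewrite -!opprD !sqnorm2N.
Qed.

(** * Discrete Jordan decompositions *)

(** The increment of [y] is a sum of a nonnegative and a nonpositive term, one
    of which vanishes: these are its positive and negative parts. *)
Lemma jordan_Delta (R : realType) n (y u b : 'rV[R]_n.+1) (k : 'I_n) :
  jordan_decomposition y u b -> Delta u 0 k = Num.max 0 (Delta y 0 k).
Proof.
move=> [[/isotoneP/(_ k) iu /antitoneP/(_ k) ab] -> _ _ /rowP/(_ k)].
rewrite DeltaD [LHS]mxE [RHS]mxE => /eqP.
rewrite mulf_eq0 => /orP[]/eqP e.
  by rewrite e add0r; case: ltgtP ab.
by rewrite e addr0; apply/esym/max_idPr.
Qed.

Lemma jordan_decomposition_exists (R : realType) n (y : 'rV[R]_n.+1) :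
  exists u b, jordan_decomposition y u b.
Proof.
have [u [du mu]] :=
  exists_Delta_mean (\row_k Num.max 0 (Delta y 0 k)) (mean y).
have duk k : Delta u 0 k = Num.max 0 (Delta y 0 k) by rewrite du mxE.
have dbk k : Delta (y - u) 0 k = Delta y 0 k - Num.max 0 (Delta y 0 k).
  by rewrite DeltaB duk.
exists u, (y - u); split=> //.
- split; first by apply/isotoneP => k; rewrite duk le_max lexx.
  by apply/antitoneP => k; rewrite dbk subr_le0 le_max lexx orbT.
- by rewrite addrC subrK.
- by rewrite meanD meanN mu subrr.
apply/rowP => k; rewrite [LHS]mxE [RHS]mxE dbk duk.
by case: leP => _; rewrite ?mul0r// subrr mulr0.
Qed.

Lemma jordan_decomposition_unique (R : realType) n (y u b u' b' : 'rV[R]_n.+1) :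
  jordan_decomposition y u b -> jordan_decomposition y u' b' ->
  u' = u /\ b' = b.
Proof.
move=> J J'; have uu : u' = u.
  apply: Delta_mean_inj.
    by apply/rowP => k; rewrite (jordan_Delta k J) (jordan_Delta k J').
  by case: J J' => _ _ -> _ _ [_ _ ->].
split=> //; case: J J' => _ -> _ _ _ [_ + _ _ _].
by rewrite uu => /addrI.
Qed.

(** At each place either [u] does not increase or [b] does not decrease, so
    the deficits [u - v] and [b - c] never vary at the same place and cannot
    compensate each other in the residual. The factor [2 * n] counts [n]
    increments of the residual, each a difference of two entries. *)
Lemma norm_deficit_le_residual (R : realType) n (y u b v c : 'rV[R]_n.+1) :
  jordan_decomposition y u b ->
  isotone v -> isotone (u - v) -> mean v = mean y ->
  antitone c -> antitone (b - c) ->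
  `|u - v| <= (2 * n)%:R * `|y - v - c|.
Proof.
move=> [[iu ab] yE muy _ ub0] iv iuv mvy ac abc.
have -> : y - v - c = (u - v) + (b - c) by rewrite yE -addrA addrACA.
set d := u - v in iuv *; set e := b - c in abc *.
have md : mean d = 0 by rewrite meanD meanN muy mvy subrr.
apply: le_trans (norm_le_sum_Delta md) _.
have step k : `|Delta d 0 k| <= 2 * `|d + e|.
  suff [->|->] : Delta d 0 k = 0 \/ Delta d 0 k = Delta (d + e) 0 k.
  - by rewrite normr0 mulr_ge0.
  - rewrite DeltaE; apply: le_trans (ler_normB _ _) _.
    by rewrite mulrDl mul1r lerD// norm_entry_le.
  move/isotoneP/(_ k): iv; move/isotoneP/(_ k): iuv.
  move/antitoneP/(_ k): ac; move/antitoneP/(_ k): abc.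
  move/rowP/(_ k): ub0; rewrite [LHS]mxE [RHS]mxE => /eqP.
  rewrite DeltaD /d /e !DeltaB.
  by rewrite mulf_eq0 => /orP[]/eqP -> *; [left|right]; lra.
apply: (@le_trans _ _ (\sum_(k < n) 2 * `|d + e|)); first exact: ler_sum.
by rewrite sumr_const card_ord -[_ *+ n]mulr_natl mulrA -natrM mulnC.
Qed.

(** * Convergence of the alternating projections *)

(** Both half-steps project a Jordan component perturbed by the deficit of the
    other one: [y - b_k = u + (b - b_k)] and [y - u_k = b + (u - u_k)]. The
    monotonicity of each deficit is thus inherited from the other, and their
    squared norms decrease along the iteration. *)
Lemma iir_step (R : realType) n (y u b : 'rV[R]_n.+1) (k : nat) :
  jordan_decomposition y u b ->
  antitone (b - iir_b y k) -> mean (iir_b y k) = 0 ->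
  [/\ isotone (u - iir_u y k.+1), mean (iir_u y k.+1) = mean y,
      antitone (b - iir_b y k.+1), mean (iir_b y k.+1) = 0 &
      sqnorm2 (b - iir_b y k.+1) + sqnorm2 (y - iir_u y k.+1 - iir_b y k.+1) <=
      sqnorm2 (b - iir_b y k)].
Proof.
move=> [[iu ab] yE _ _ _] abk mbk.
have nu := nearest_iso (y - iir_b y k); rewrite -/(iir_u y k.+1) in nu.
have nb := nearest_anti (y - iir_u y k.+1); rewrite -/(iir_b y k.+1) in nb.
have yu : y - iir_b y k = u + (b - iir_b y k) by rewrite yE addrA.
have yb : y - iir_u y k.+1 = b + (u - iir_u y k.+1) by rewrite yE addrAC addrC.
rewrite yu in nu; rewrite yb in nb.
have [iuk muk suk] := isotone_step iu abk nu.
have [abk1 mbk1 sbk] := antitone_step ab iuk nb.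
have muy : mean (iir_u y k.+1) = mean y.
  by rewrite muk -yu meanD meanN mbk subr0.
split=> //; first by rewrite mbk1 -yb meanD meanN muy subrr.
rewrite yb; apply: le_trans sbk _; apply: le_trans suk.
by rewrite lerDl sqnorm2_ge0.
Qed.

Lemma iir_b_invariant (R : realType) n (y u b : 'rV[R]_n.+1) (k : nat) :
  jordan_decomposition y u b ->
  antitone (b - iir_b y k) /\ mean (iir_b y k) = 0.
Proof.
move=> J; elim: k => [|k [abk mbk]]; last by have [] := iir_step J abk mbk.
split; first by rewrite subr0; case: J => -[].
by rewrite /mean big1 ?mul0r// => i _; rewrite mxE.
Qed.

(** The squared residuals are bounded by the drops of a nonincreasing
    nonnegative sequence. *)
Lemma cvg_iir_residual (R : realType) n (y u b : 'rV[R]_n.+1) :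
  jordan_decomposition y u b ->
  `|y - iir_u y k.+1 - iir_b y k.+1| @[k --> \oo] --> (0 : R).
Proof.
move=> J; pose E k := sqnorm2 (b - iir_b y k).
have drop k : `|y - iir_u y k.+1 - iir_b y k.+1| ^+ 2 <= E k - E k.+1.
  have [abk mbk] := iir_b_invariant k J.
  have [_ _ _ _] := iir_step J abk mbk.
  rewrite -/(E k) -/(E k.+1).
  by have := sqr_norm_le_sqnorm2 (y - iir_u y k.+1 - iir_b y k.+1); lra.
have Ecvg : cvgn E.
  apply: nonincreasing_is_cvgn; last first.
    by exists 0 => _ [k _ <-]; exact: sqnorm2_ge0.
  apply/nonincreasing_seqP => k; rewrite -subr_ge0.
  exact: le_trans (sqr_ge0 _) (drop k).
have drop0 : E k - E k.+1 @[k --> \oo] --> (0 : R).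
  rewrite -(subrr (limn E)); apply: cvgB; first exact: Ecvg.
  by rewrite (cvg_shiftS E).
have sqrt0 : Num.sqrt (E k - E k.+1) @[k --> \oo] --> (0 : R).
  rewrite -(sqrtr0 R).
  exact: (cvg_comp _ _ drop0 (@sqrt_continuous R 0)).
apply: (squeeze_cvgr _ (cvg_cst 0) sqrt0); near=> k.
by rewrite normr_ge0 -[leLHS]ger0_norm// -sqrtr_sqr ler_wsqrtr.
Unshelve. all: by end_near.
Qed.

Lemma cvg_iir_u (R : realType) n (y u b : 'rV[R]_n.+1) :
  jordan_decomposition y u b -> iir_u y k.+1 @[k --> \oo] --> u.
Proof.
move=> J; apply/subr_cvg0; apply/norm_cvg0P.
have rate0 : (2 * n)%:R * `|y - iir_u y k.+1 - iir_b y k.+1| @[k --> \oo]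
    --> (0 : R).
  by rewrite -[X in _ --> X](mulr0 (2 * n)%:R); apply: cvgMr;
    exact: cvg_iir_residual J.
apply: (squeeze_cvgr _ (cvg_cst 0) rate0); near=> k.
rewrite normr_ge0 distrC.
have [abk mbk] := iir_b_invariant k J.
have [iuk muk abk1 _ _] := iir_step J abk mbk.
apply: norm_deficit_le_residual J _ iuk muk _ abk1.
  exact: (nearest_iso _).1.
exact: (nearest_anti _).1.
Unshelve. all: by end_near.
Qed.

Lemma cvg_iir_b (R : realType) n (y u b : 'rV[R]_n.+1) :
  jordan_decomposition y u b -> iir_b y k @[k --> \oo] --> b.
Proof.
move=> J; rewrite -(cvg_shiftS (iir_b y)).
have -> : [sequence iir_b y k.+1]_k =
    (fun k => y - iir_u y k.+1 - (y - iir_u y k.+1 - iir_b y k.+1)).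
  by apply/funext => k; rewrite subKr.
have -> : b = y - u - 0.
  by case: J => _ -> _ _ _; rewrite subr0 addrAC subrr add0r.
apply: cvgB; last exact/norm_cvg0P/(cvg_iir_residual J).
by apply: cvgB; [exact: cvg_cst | exact: cvg_iir_u J].
Qed.

Theorem corollary3 (R : realType) (n : nat) (y : 'rV[R]_n.+1) :
  exists u b : 'rV[R]_n.+1,
    [/\ jordan_decomposition y u b,
        forall u' b' : 'rV[R]_n.+1,
          jordan_decomposition y u' b' -> u' = u /\ b' = b,
        iir_u y k @[k --> \oo] --> u &
        iir_b y k @[k --> \oo] --> b].
Proof.
have [u [b J]] := jordan_decomposition_exists y; exists u, b; split=> //.
- by move=> u' b'; exact: jordan_decomposition_unique.
- by rewrite -(cvg_shiftS (iir_u y)); exact: cvg_iir_u J.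
exact: cvg_iir_b J.
Qed.
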